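(* In the class of all graphs, the property of having size at most continuum is expressible in the modal language of graph theory: there is a sentence $\psi_{\leq\mathfrak{c}}\in\mathcal{L}_\sim^{\Diamond}$ such that for every graph $G$, $$G\models\psi_{\leq\mathfrak{c}}\quad\text{if and only if}\quad |G|\leq\mathfrak{c}.$$
   Context: $|G|$ is the cardinality of the vertex set of $G$ and $\mathfrak{c}=2^{\aleph_0}$. A graph is a set of vertices (of any cardinality) together with an irreflexive symmetric binary edge relation $\sim$. $\mathcal{L}_\sim$ is the first-order language (with equality) whose only non-logical symbol is the binary relation symbol $\sim$. $\mathcal{L}_\sim^{\Diamond}$ is the full first-order modal language, closing $\mathcal{L}_\sim$ under the modal operators $\Diamond,\Box$, Boolean connectives and quantifiers. Formulas are evaluated at graphs, within the class of all graphs under the substructure relation: $G\models\Diamond\varphi[\bar a]$ iff there is a graph $H$ containing $G$ as a substructure (i.e. $G$ is an induced subgraph of $H$) with $H\models\varphi[\bar a]$; $G\models\Box\varphi[\bar a]$ iff $H\models\varphi[\bar a]$ for every graph $H$ containing $G$ as a substructure; Boolean connectives and quantifiers are interpreted as usual, with quantifiers ranging over the vertices of the graph at which the formula is evaluated. *)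

(* Defs.v *)
From mathcomp Require Import all_boot.
From mathcomp Require Import classical_sets cardinality.
Set Implicit Arguments.
Unset Strict Implicit.
Unset Printing Implicit Defensive.

Record graph : Type := Graph {
  vertex :> Type;
  adj : vertex -> vertex -> Prop;
  adj_irrefl : forall x, ~ adj x x;
  adj_sym : forall x y, adj x y -> adj y x
}.

(* [G] is a substructure of [H] up to renaming of vertices: [f] identifies [G]
   with the subgraph of [H] induced on the range of [f].  Satisfaction is
   invariant under isomorphism, so allowing such an identification instead of a
   literal inclusion of vertex sets does not affect the modal semantics. *)
Definition induced_embedding (G H : graph) (f : G -> H) : Prop :=
  injective f /\ forall x y : G, adj x y <-> adj (f x) (f y).

(* Formulas are well scoped: the free variables of a [formula n] are among
   0, ..., n - 1, and the sentences are the elements of [formula 0].  Under a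
   quantifier, variable 0 is the bound one and the others are shifted by one.
   The values of the free variables form an [n.-tuple], so that a sentence can
   also be evaluated at the empty graph. *)
Inductive formula : nat -> Type :=
| fEq n (i j : 'I_n) : formula n
| fAdj n (i j : 'I_n) : formula n
| fNot n (p : formula n) : formula n
| fAnd n (p q : formula n) : formula n
| fOr n (p q : formula n) : formula n
| fImp n (p q : formula n) : formula n
| fAll n (p : formula n.+1) : formula n
| fEx n (p : formula n.+1) : formula n
| fDia n (p : formula n) : formula n
| fBox n (p : formula n) : formula n.

Fixpoint sat n (p : formula n) (G : graph) : n.-tuple G -> Prop :=
  match p in formula m return m.-tuple G -> Prop with
  | fEq _ i j => fun a => tnth a i = tnth a j
  | fAdj _ i j => fun a => adj (tnth a i) (tnth a j)
  | fNot _ p => fun a => ~ sat p a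
  | fAnd _ p q => fun a => sat p a /\ sat q a
  | fOr _ p q => fun a => sat p a \/ sat q a
  | fImp _ p q => fun a => sat p a -> sat q a
  | fAll _ p => fun a => forall x : G, sat p [tuple of x :: a]
  | fEx _ p => fun a => exists x : G, sat p [tuple of x :: a]
  | fDia _ p => fun a => exists (H : graph) (f : G -> H),
      induced_embedding f /\ sat p [tuple of map f a]
  | fBox _ p => fun a => forall (H : graph) (f : G -> H),
      induced_embedding f -> sat p [tuple of map f a]
  end.

Definition sentence : Type := formula 0.

Definition models (G : graph) (p : sentence) : Prop := sat p [tuple of [::] : seq G].

(* Main.v *)
(* [G] has at most continuum many vertices iff some extension of [G] contains a
   vertex [a] whose neighbourhood [N] is a connected graph of degree at most 2
   (hence countable) such that any two vertices of the extension have different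
   traces on [N].  For the converse, extend [G] by a ray and an apex adjacent to
   the whole ray, and code every vertex of [G] by its trace on the ray.

   Connectedness of [N] is the modal part: [z] and [y] are connected in [N] iff
   in every extension each vertex [b] adjacent to [z] whose neighbourhood is
   closed under adjacency in the current neighbourhood of [a] is adjacent to
   [y].  That neighbourhood may have grown in the extension, which is harmless:
   a path in [N] remains one, and a new vertex [b] adjacent exactly to the
   component of [z] witnesses a failure of connectedness. *)
Require Import Defs.
From mathcomp Require Import all_boot.
From mathcomp Require Import classical_sets cardinality.
From mathcomp Require Import boolp functions zify.
Local Open Scope classical_set_scope.
Local Open Scope card_scope.

(* The remainder makes [var] total while [var n k] still computes to [k] for
   concrete [k <= n]. *)
Definition var n k : 'I_n.+1 := Ordinal (ltn_pmod k (ltn0Sn n)).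
Local Notation "# k" := (var _ k) (at level 1, format "# k").
Local Infix "~~>" := fImp (at level 55, right associativity).

(* Outermost variables: [a], then [z], a neighbour of [a]. *)
Definition continuum_sentence : sentence :=
  fDia (fEx (fEx (fAnd (fAdj #0 #1) (fAnd
    (fAll (fEx (fEx (fAll
       (fAdj #3 #5 ~~> fAdj #0 #5 ~~> fAdj #0 #3 ~~>
        fOr (fEq #0 #2) (fEq #0 #1))))))
    (fAnd
      (fAll (fAdj #0 #2 ~~>
         fBox (fAll (fAdj #0 #2 ~~>
           fAll (fAll (fAdj #1 #5 ~~> fAdj #0 #5 ~~> fAdj #1 #0 ~~>
             fAdj #2 #1 ~~> fAdj #2 #0)) ~~>
           fAdj #0 #1))))
      (fAll (fAll
        (fAll (fAdj #0 #4 ~~>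
           fAnd (fAdj #0 #2 ~~> fAdj #0 #1) (fAdj #0 #1 ~~> fAdj #0 #2)) ~~>
         fEq #1 #0)))))))).

Section Separator.

Context {H : graph}.
Implicit Types a z y : H.

Definition degree_le2_in a := forall u, exists v w, forall t,
  adj u a -> adj t a -> adj t u -> t = v \/ t = w.

Definition preserves_connection a z y :=
  forall (K : graph) (f : H -> K), induced_embedding f -> forall b : K,
    adj b (f z) ->
    (forall u v : K, adj u (f a) -> adj v (f a) -> adj u v ->
       adj b u -> adj b v) ->
    adj b (f y).

Definition separated_by a := forall x y,
  (forall n, adj n a -> (adj n x -> adj n y) /\ (adj n y -> adj n x)) -> x = y.

End Separator.

(** The predicates of the section above follow the nesting of quantifiers and implications in
    [continuum_sentence], so both sides agree by conversion. *)
Lemma models_continuum_sentence (G : graph) :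
  models G continuum_sentence <->
  exists (H : graph) (f : G -> H), induced_embedding f /\
    exists a z : H, adj z a /\ degree_le2_in a /\
      (forall y, adj y a -> preserves_connection a z y) /\ separated_by a.
Proof. by []. Qed.

Definition add_vertex_adj (H : graph) (S : set H) (x y : option H) : Prop :=
  match x, y with
  | Some u, Some v => adj u v
  | Some u, None | None, Some u => S u
  | None, None => False
  end.

Lemma add_vertex_irrefl (H : graph) (S : set H) x : ~ add_vertex_adj H S x x.
Proof. by case: x => [u|] //=; exact: adj_irrefl. Qed.

Lemma add_vertex_sym (H : graph) (S : set H) x y :
  add_vertex_adj H S x y -> add_vertex_adj H S y x.
Proof. by case: x y => [u|] [v|] //=; exact: adj_sym. Qed.

Definition add_vertex (H : graph) (S : set H) : graph :=
  @Graph (option H) (add_vertex_adj H S) (add_vertex_irrefl H S)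
    (add_vertex_sym H S).

Lemma preserves_connectionP (H : graph) (a z y : H) : adj z a ->
  preserves_connection a z y <->
  forall S : set H, S z ->
    (forall u v, adj u a -> adj v a -> adj u v -> S u -> S v) -> S y.
Proof.
move=> za; split=> [conn S Sz Scl | conn K f [_ femb] b bz bcl].
  (* Cutting [S] down to the neighbours of [a] keeps the new vertex [None] non-adjacent to [a], so
     the closure condition meets no new neighbour of [a]. *)
  pose T := S `&` [set u | adj u a].
  have emb : induced_embedding (Some : H -> add_vertex H T).
    by split=> // u v [].
  suff [] : T y by [].
  apply: (conn _ _ emb None (conj Sz za)) => -[u|] [v|] //=.
  - by move=> ua va uv [Su _]; split=> //; exact: Scl uv Su.
  - by move=> _ [_ /adj_irrefl].
apply: (conn [set u | adj b (f u)]) => //= u v ua va uv.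
by apply: bcl; apply/femb.
Qed.

(** Finite boolean words, read as walks from [z] that choose one of two candidate neighbours at each
    step, reach every neighbour of [a]. Walks may also leave this neighbourhood, which is harmless:
    the code of a vertex is its trace on all of them. *)
Lemma connected_separator_card (H : graph) (a z : H) :
  adj z a -> degree_le2_in a ->
  (forall y, adj y a -> preserves_connection a z y) ->
  separated_by a ->
  exists code : H -> nat -> bool, injective code.
Proof.
move=> za /choice[f0 /choice[f1 nbr]] conn sep.
pose walk (s : seq bool) := foldr (fun b u => if b then f0 u else f1 u) z s.
have walk_surj y : adj y a -> exists s, walk s = y.
  move=> ya; have /(preserves_connectionP _ _ _ _ za) reach := conn y ya.
  apply: (reach [set y | exists s, walk s = y]); first by exists [::].
  move=> u v ua va uv [s su].
  have [->|->] := nbr u v ua va (adj_sym uv).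
  - by exists (true :: s); rewrite /= su.
  - by exists (false :: s); rewrite /= su.
exists (fun x n =>
  if unpickle n is Some s then `[< adj (walk s) x >] else false).
move=> x y xy; apply: sep => n /walk_surj[s <-].
move/(congr1 (@^~ (pickle s))): xy; rewrite pickleK => xy.
by have [] := asbool_eq_equiv xy.
Qed.

(* The prefix 0, 1, 1 is the start of the trace of neither a ray vertex nor the
   apex. *)
Definition pad (c : nat -> bool) (n : nat) : bool :=
  match n with 0 => false | 1 | 2 => true | n.+3 => c n end.

Lemma pad_inj (c d : nat -> bool) : pad c =1 pad d -> c =1 d.
Proof. by move=> cd n; exact: (cd n.+3). Qed.

Definition ray_adj (m n : nat) : Prop := n = m.+1 \/ m = n.+1.

Section RayExtension.

Context {G : graph}.
Variable c : G -> nat -> bool.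

Definition ray_extension_adj (x y : G + option nat) : Prop :=
  match x, y with
  | inl g, inl h => adj g h
  | inl g, inr (Some n) | inr (Some n), inl g => pad (c g) n
  | inr (Some m), inr (Some n) => ray_adj m n
  | inr (Some _), inr None | inr None, inr (Some _) => True
  | inl _, inr None | inr None, inl _ | inr None, inr None => False
  end.

Lemma ray_extension_irrefl x : ~ ray_extension_adj x x.
Proof.
case: x => [g|[n|]] //=; [exact: adj_irrefl | by rewrite /ray_adj; lia].
Qed.

Lemma ray_extension_sym x y : ray_extension_adj x y -> ray_extension_adj y x.
Proof.
case: x y => [g|[m|]] [h|[n|]] //=; [exact: adj_sym | by rewrite /ray_adj; lia].
Qed.

Definition ray_extension : graph :=
  @Graph (G + option nat) ray_extension_adj ray_extension_irrefl
    ray_extension_sym.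

Definition apex : ray_extension := inr None.
Definition ray n : ray_extension := inr (Some n).

Lemma adj_apexP (x : ray_extension) : adj x apex -> exists n, x = ray n.
Proof. by case: x => [g|[n|]] //= _; exists n. Qed.

Lemma ray_extension_embedding :
  induced_embedding (inl : G -> ray_extension).
Proof. by split=> // u v []. Qed.

Lemma ray_degree_le2 : degree_le2_in apex.
Proof.
case=> [g|[n|]]; [by exists apex, apex | | by exists apex, apex].
(* For [n = 0] the first candidate is [ray 0] itself, a harmless dummy. *)
exists (ray n.-1), (ray n.+1) => t _ /adj_apexP[m ->] /= mn.
have [->|->] : m = n.-1 \/ m = n.+1 by rewrite /ray_adj in mn; lia.
- by left.
- by right.
Qed.

Lemma ray_connected y : adj y apex -> preserves_connection apex (ray 0) y.
Proof.
move=> /adj_apexP[n ->]; apply/preserves_connectionP => // S S0 Scl.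
by elim: n => // n; apply: Scl => //; left.
Qed.

Lemma ray_separates : injective c -> separated_by apex.
Proof.
move=> cinj x y xy.
have {}xy n : adj (ray n) x <-> adj (ray n) y.
  by have [] := xy (ray n) I.
case: x y xy => [g|[m|]] [h|[n|]] /= xy //.
- congr inl; apply/cinj/funext/pad_inj => n.
  by apply/idP/idP => /xy.
- by have := xy 1; have := xy 2; rewrite /= /ray_adj; lia.
- by have := xy 0; case=> _ /(_ I).
- by have := xy 1; have := xy 2; rewrite /= /ray_adj; lia.
(* Testing [ray m.+1] leaves [n = m] or [n = m.+2]; testing [ray n.+1] excludes the latter. *)
- have -> // : m = n.
  by have := xy m.+1; have := xy n.+1; rewrite /= /ray_adj; lia.
- by have := xy m; rewrite /= /ray_adj; lia.
- by have := xy 0; case=> /(_ I).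
- by have := xy n; rewrite /= /ray_adj; lia.
Qed.

End RayExtension.

Theorem theorem6 :
  exists psi : sentence,
    forall G : graph, models G psi <-> [set: G] #<= [set: nat -> bool].
Proof.
exists continuum_sentence => G; split.
- case/models_continuum_sentence=> [H [f [[finj _] [a [z]]]]].
  move=> [za [deg [conn sep]]].
  have [code code_inj] := connected_separator_card H a z za deg conn sep.
  apply/pcard_injP; exists (code \o f) => x y _ _ /code_inj; exact: finj.
- move=> /pcard_injP[c cinj].
  apply/models_continuum_sentence; exists (ray_extension c), inl.
  split; first exact: ray_extension_embedding.
  exists (apex c), (ray c 0); split=> //; split; first exact: ray_degree_le2.
  split; first exact: ray_connected.
  by apply: ray_separates => x y; apply: cinj; rewrite in_setT.
Qed.
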